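(* Let $(W,S)$ be an arbitrary Coxeter system and let $\underline{w}=(s_1,\ldots,s_n)$ be any expression (a finite sequence of elements of $S$, not necessarily reduced). Then the Bott--Samelson ring $\overline{\mathrm{BS}}(\underline{w})=\mathbb{R}[x_1,\ldots,x_n]/(q_1,\ldots,q_n)$ is a Koszul $\mathbb{R}$-algebra.
   Context: A Coxeter system $(W,S)$ has $S$ finite, $W=\langle s\in S\mid (st)^{m_{st}}=\mathrm{id}\text{ for } s,t\in S,\ m_{st}<\infty\rangle$, with $m_{ss}=1$ and $m_{st}=m_{ts}\in\{2,3,\ldots\}\cup\{\infty\}$ for $s\ne t$. Convention: $\pi/m_{st}=0$ if $m_{st}=\infty$. Bott--Samelson ring (generators and relations): let $\tilde R_{\underline{w}}=(\tilde r_{ij})_{1\le i,j\le n}$ with $\tilde r_{ij}=\cos\frac{\pi}{m_{s_is_j}}$ if $i<j$ and $\tilde r_{ij}=0$ if $i\ge j$, and let $Q_{\underline{w}}=(q_{ij})_{1\le i,j\le n}:=\tilde R_{\underline{w}}+\tilde R_{\underline{w}}^2+\cdots+\tilde R_{\underline{w}}^n$. Then $$\overline{\mathrm{BS}}(\underline{w}):=\mathbb{R}[x_1,\ldots,x_n]/(q_1,\ldots,q_n),\qquad q_m:=x_m^2-\Bigl(\sum_{l=1}^{m-1}q_{lm}x_l\Bigr)^2,$$ graded with $\deg x_i=1$. A Koszul algebra $A$ over a field $k$ is a graded $k$-algebra such that $k$ has a linear graded free resolution over $A$, i.e. there is an exact sequence of graded $A$-modules (with degree-preserving maps) $$\cdots\to(A(-i))^{b_i}\to\cdots\to(A(-1))^{b_1}\to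 A\to k\to0$$ for some non-negative integers $b_i$, where $A(-j)$ is $A$ with grading shifted up by $j$ (so the maps between free modules are given by matrices whose entries are $0$ or linear forms). *)

(* Defs.v *)
From HB Require Import structures.
From mathcomp Require Import all_boot all_order all_algebra.
From mathcomp Require Import boolp classical_sets reals trigo.
(* The notations of mpoly clash with those of mathcomp-analysis. *)
From mathcomp Require Import -(notations) mpoly.

Set Implicit Arguments.
Unset Strict Implicit.
Unset Printing Implicit Defensive.

Import GRing.Theory.

Local Open Scope ring_scope.
Local Open Scope quotient_scope.

(* [Some k] stands for the finite value m_{st} = k, [None] for infinity. *)
Record coxeterMatrix (S : finType) := CoxeterMatrix {
  cox_entry :> S -> S -> option nat;
  _ : forall s, cox_entry s s = Some 1%N;
  _ : forall s t, cox_entry s t = cox_entry t s;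
  _ : forall s t k, s != t -> cox_entry s t = Some k -> (2 <= k)%N }.

Definition coxeter_relations (S : finType) (m : coxeterMatrix S)
    (G : groupType) (f : S -> G) : Prop :=
  forall s t k, m s t = Some k -> ((f s * f t) ^+ k = 1)%g.

(* W = < S | (st)^{m_{st}} = 1 for m_{st} finite >, expressed by the universal
   property of the presentation. *)
Definition coxeter_presentation (S : finType) (m : coxeterMatrix S)
    (W : groupType) (gen : S -> W) : Prop :=
  coxeter_relations m gen /\
  forall (G : groupType) (f : S -> G), coxeter_relations m f ->
    exists phi : {multiplicative W -> G},
      (forall s, phi (gen s) = f s) /\
      (forall psi : {multiplicative W -> G},
         (forall s, psi (gen s) = f s) -> psi =1 phi).

Record coxeterSystem := CoxeterSystem {
  cox_group : groupType;
  cox_set : finType;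
  cox_gen : cox_set -> cox_group;
  cox_matrix : coxeterMatrix cox_set;
  _ : coxeter_presentation cox_matrix cox_gen }.

Record is_graded_algebra (k : fieldType) (A : algType k) (G : nat -> set A) :
    Prop := IsGradedAlgebra {
  graded0 : forall d, G d 0;
  gradedP : forall d (c : k) (x y : A), G d x -> G d y -> G d (c *: x + y);
  graded1 : G 0%N 1;
  gradedM : forall d e (x y : A), G d x -> G e y -> G (d + e)%N (x * y);
  graded_sum : forall x : A, exists (N : nat) (c : nat -> A),
    (forall d, G d (c d)) /\ x = \sum_(0 <= d < N) c d;
  graded_direct : forall (N : nat) (c : nat -> A), (forall d, G d (c d)) ->
    \sum_(0 <= d < N) c d = 0 -> forall d, (d < N)%N -> c d = 0 }.

(* The homogeneous elements of degree e of the free module A(-i)^r, i.e. the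
   vectors with all entries in A_{e-i} (which is 0 if e < i). *)
Definition twist_deg (k : fieldType) (A : algType k) (G : nat -> set A)
    (i r e : nat) : set 'rV[A]_r :=
  [set v | forall j, if (i <= e)%N then G (e - i)%N (v 0 j) else v 0 j = 0].

(* Ranks of the resolution, whose term in homological degree 0 is A itself;
   the value b 0 is not used. *)
Definition res_rank (b : nat -> nat) (i : nat) : nat :=
  if i is _.+1 then b i else 1%N.

(* Exactness of ... -> A(-i)^(b i) -> ... -> A(-1)^(b 1) -> A -> k -> 0 by
   degree-preserving A-linear maps. The A-module structure of k and the map
   A -> k are both given by the augmentation eps, which is degree-preserving
   for k concentrated in degree 0. *)
Definition is_linear_resolution (k : fieldType) (A : algType k)
    (G : nat -> set A) (eps : {lrmorphism A -> k^o}) (b : nat -> nat)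
    (d : forall i,
       {linear 'rV[A]_(res_rank b i.+1) -> 'rV[A]_(res_rank b i)}) : Prop :=
  [/\ forall e a, (0 < e)%N -> G e a -> eps a = 0,
      forall i e v, twist_deg G i.+1 e v -> twist_deg G i e (d i v),
      forall c : k, exists a, eps a = c,
      forall v : 'rV[A]_1, eps (v 0 0) = 0 <-> exists u, d 0%N u = v
    & forall i v, d i v = 0 <-> exists u, d i.+1 u = v].

Definition koszul (k : fieldType) (A : algType k) (G : nat -> set A) : Prop :=
  is_graded_algebra G /\
  exists (eps : {lrmorphism A -> k^o}) (b : nat -> nat)
    (d : forall i,
       {linear 'rV[A]_(res_rank b i.+1) -> 'rV[A]_(res_rank b i)}),
    is_linear_resolution G eps d.

(* The quotient of a commutative algebra by a (proper) ideal as an algebra. *)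
Section IdealQuotientAlgebra.
Variables (k : comNzRingType) (A : comAlgType k) (I : idealr A).
Local Notation Q := {ideal_quot I}.

Definition idealq_scale (c : k) (x : Q) : Q := \pi_Q (c%:A) * x.

Lemma idealq_scaleA c1 c2 x :
  idealq_scale c1 (idealq_scale c2 x) = idealq_scale (c1 * c2) x.
Proof.
by rewrite /idealq_scale mulrA -rmorphM -scalerAl mul1r scalerA.
Qed.

Lemma idealq_scale1 : left_id 1 idealq_scale.
Proof. by move=> x; rewrite /idealq_scale scale1r rmorph1 mul1r. Qed.

Lemma idealq_scaleDr : right_distributive idealq_scale +%R.
Proof. by move=> c x y; rewrite /idealq_scale mulrDr. Qed.

Lemma idealq_scaleDl x : {morph idealq_scale^~ x : a b / a + b}.
Proof. by move=> a b; rewrite /idealq_scale scalerDl rmorphD mulrDl. Qed.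

HB.instance Definition _ := GRing.Zmodule_isLmodule.Build k Q
  idealq_scaleA idealq_scale1 idealq_scaleDr idealq_scaleDl.

Lemma idealq_scaleAl (c : k) (x y : Q) : c *: (x * y) = (c *: x) * y.
Proof. exact: mulrA. Qed.

HB.instance Definition _ := GRing.Lmodule_isLalgebra.Build k Q idealq_scaleAl.
HB.instance Definition _ := GRing.Lalgebra_isComAlgebra.Build k Q.

Lemma pi_idealq_scale (c : k) (a : A) : \pi_Q (c *: a) = c *: \pi_Q a.
Proof. by rewrite -[a in LHS]mul1r scalerAl rmorphM. Qed.
End IdealQuotientAlgebra.

Section BottSamelson.
Variables (R : realType) (C : coxeterSystem) (n : nat).
Variable w : n.-tuple (cox_set C).

Local Notation X i := (mpolyX R (mnm1 i)).

Definition cox_angle (s t : cox_set C) : R :=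
  if cox_matrix C s t is Some k then pi / k%:R else 0.

Definition bs_Rt : 'M[R]_n :=
  \matrix_(i, j) (if (i < j)%N then cos (cox_angle (tnth w i) (tnth w j))
                  else 0).

Definition bs_Q : 'M[R]_n := \sum_(1 <= k < n.+1) bs_Rt ^+ k.

Definition bs_q (m : 'I_n) : mpoly n R :=
  X m ^+ 2 - (\sum_(l < n | (l < m)%N) bs_Q l m *: X l) ^+ 2.

Definition bs_ideal : {pred mpoly n R} :=
  fun p => `[< exists c : 'I_n -> mpoly n R, p = \sum_m c m * bs_q m >].

Lemma mcoeff0_bs_q m : mcoeff mnm0 (bs_q m) = 0.
Proof.
have X0 i : mcoeff mnm0 (X i) = 0 by rewrite mcoeffX mnm1_eq0.
rewrite /bs_q rmorphB !rmorphXn /= X0 raddf_sum /=.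
rewrite big1 => [|l _]; last by rewrite mcoeffZ X0 mulr0.
by rewrite expr0n subrr.
Qed.

Lemma bs_ideal_closed : idealr_closed bs_ideal.
Proof.
split.
- by apply/asboolP; exists (fun _ => 0); rewrite big1 // => i _; rewrite mul0r.
- apply/asboolP => -[c] /(congr1 (mcoeff mnm0)) /eqP.
  rewrite raddf_sum big1 => [|i _]; last first.
    by rewrite /= rmorphM /= mcoeff0_bs_q mulr0.
  by rewrite mcoeff1 eqxx oner_eq0.
- move=> a u v /asboolP[c ->] /asboolP[d ->]; apply/asboolP.
  exists (fun m => a * c m + d m).
  by rewrite mulr_sumr -big_split; apply: eq_bigr => i _; rewrite mulrDl mulrA.
Qed.

HB.instance Definition _ := isIdealr.Build (mpoly n R) bs_ideal bs_ideal_closed.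

Definition BS : comAlgType R := {ideal_quot bs_ideal}.

(* The image of the grading of R[x_1, ..., x_n] with deg x_i = 1. *)
Definition BS_deg (d : nat) : set BS :=
  [set \pi_{ideal_quot bs_ideal} p | p in [set p | p \is ishomog1 d mdeg]]%classic.
End BottSamelson.

Arguments BS_deg R {C n} w d.

(* Main.v *)
(* Modulo the earlier variables x_1, ..., x_{i-1} the relation q_i becomes x_i^2,
   and the later relations are monic in later variables, so the ideals
   J_i = (x_1, ..., x_i) of the Bott-Samelson ring satisfy J_{i-1} : x_i = J_i.
   Hence J_0 < J_1 < ... < J_n is a Koszul filtration. Consider a module
   generated by linear vectors v_1, ..., v_s such that each colon ideal
   (v_1, ..., v_{i-1}) : v_i is some J_m. Lifting each generator of each of
   these J_m to a linear syzygy yields generators of the syzygy module of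
   v_1, ..., v_s, and by the colon identity they have the same property.
   Iterating from x_1, ..., x_n gives a linear resolution of the residue field. *)
Require Import Defs.
From HB Require Import structures.
From mathcomp Require Import all_boot all_order all_algebra.
From mathcomp Require Import boolp classical_sets reals.
From mathcomp Require Import -(notations) mpoly.
From mathcomp Require Import ssrcomplements.

Set Implicit Arguments.
Unset Strict Implicit.
Unset Printing Implicit Defensive.

Import GRing.Theory.

Local Open Scope ring_scope.

(** * Linear maps of polynomials given on the monomial basis *)

Section MonomialMaps.
Variables (R : comNzRingType) (n : nat).
Local Notation P := (mpoly n R).
Local Notation X i := (mpolyX R (mnm1 i)).
Implicit Types (p : P) (m : multinom n).

Section Def.
Variable F : multinom n -> P.

Definition mlin p : P := \sum_(m <- msupp p) mcoeff m p *: F m.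

Lemma mlinwE k p : (msize p <= k)%N ->
  mlin p = \sum_(m : bmultinom n k) mcoeff m p *: F m.
Proof.
move=> lt_pk; rewrite /mlin (big_mksub (bmultinom n k)) //=; first last.
- by move=> m /msize_mdeg_lt /leq_trans; apply.
- exact: msupp_uniq.
by rewrite big_rmcond //= => m /memN_msupp_eq0 ->; rewrite scale0r.
Qed.

Lemma mlin_is_linear : linear mlin.
Proof.
move=> c p q; set k := maxn (maxn (msize p) (msize q)) (msize (c *: p + q)).
rewrite (@mlinwE k) ?leq_maxr// (@mlinwE k p) ?(@mlinwE k q); first last.
- by rewrite /k !leq_max leqnn.
- by rewrite /k !leq_max leqnn orbT.
rewrite scaler_sumr -big_split; apply: eq_bigr => m _ /=.
by rewrite linearP /= scalerDl scalerA.
Qed.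

HB.instance Definition _ :=
  GRing.isLinear.Build R P P _ mlin mlin_is_linear.

Lemma mlinX m : mlin (mpolyX R m) = F m.
Proof. by rewrite /mlin msuppX big_seq1 mcoeffX eqxx scale1r. Qed.

Lemma mlinMX m g p : (forall m', F (mnm_add m m') = g * F m') ->
  mlin (mpolyX R m * p) = g * mlin p.
Proof.
move=> Fm; rewrite [p in LHS]mpolyE mulr_sumr linear_sum mulr_sumr.
by apply: eq_bigr => m' _; rewrite -scalerAr -mpolyXD linearZ /= mlinX Fm scalerAr.
Qed.

End Def.

Lemma mcoeffMX_eq0 p m m' : ~~ lem m m' -> mcoeff m' (p * mpolyX R m) = 0.
Proof.
move=> nle; apply/eqP; rewrite mcoeff_eq0; apply: contra nle.
rewrite (perm_mem (msuppMX _ _)) => /mapP[k _ ->].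
by apply/mnm_lepP => i; rewrite mnmDE leq_addr.
Qed.

End MonomialMaps.

(** * Reduction modulo the relations, and the colon identity in the polynomial ring *)

Section SquareDifferences.
Variables (R : comNzRingType) (n : nat) (a : 'I_n -> 'I_n -> R).
Local Notation P := (mpoly n R).
Local Notation X i := (mpolyX R (mnm1 i)).
Implicit Types (p : P) (m l i : 'I_n).

Definition lower_form m : P := \sum_(l < n | (l < m)%N) a l m *: X l.

Definition square_diff m : P := X m ^+ 2 - lower_form m ^+ 2.

(* Reduction modulo square_diff m, viewed as a monic polynomial in X m. *)
Definition red_mnm m (b : multinom n) : P :=
  mpolyX R (Multinom [tuple if i == m then odd (b i) : nat else b i | i < n])
  * lower_form m ^+ (b m)./2.*2.

Definition red m : {linear P -> P} := mlin (red_mnm m).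

Lemma red_mulX m l p : l != m -> red m (X l * p) = X l * red m p.
Proof.
move=> lm; apply: mlinMX => b; rewrite /red_mnm mulrA -mpolyXD mnmDE mnm1E.
rewrite (negPf lm) add0n; congr (mpolyX _ _ * _); apply/mnmP => i.
by rewrite !mnmE; case: eqP => // ->; rewrite (negPf lm).
Qed.

Lemma red_mulXX m p : red m (X m ^+ 2 * p) = lower_form m ^+ 2 * red m p.
Proof.
rewrite expr2 -mpolyXD; apply: mlinMX => b.
rewrite /red_mnm mulrCA; congr (mpolyX _ _ * _).
  apply/mnmP => i; rewrite !mnmE; case: eqP => [->|/eqP im].
    by rewrite eqxx /=; case: (odd _).
  by rewrite eq_sym (negPf im).
by rewrite !mnmDE mnm1E eqxx -exprD.
Qed.

Lemma linear_lower_form (f : {linear P -> P}) m p :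
  (forall l q, (l < m)%N -> f (X l * q) = X l * f q) ->
  f (lower_form m * p) = lower_form m * f p.
Proof.
move=> fX; rewrite !mulr_suml linear_sum; apply: eq_bigr => l lm.
by rewrite -!scalerAl linearZ /= fX.
Qed.

Lemma linear_square_diff (f : {linear P -> P}) m p :
  (forall l q, (l <= m)%N -> f (X l * q) = X l * f q) ->
  f (square_diff m * p) = square_diff m * f p.
Proof.
move=> fX; have fl q : f (lower_form m * q) = lower_form m * f q.
  by apply: linear_lower_form => l r /ltnW; apply: fX.
by rewrite mulrBl raddfB /= !expr2 -!mulrA !fX// !fl !mulrA -mulrBl.
Qed.

Lemma red_lower_form m l p : (l <= m)%N ->
  red m (lower_form l * p) = lower_form l * red m p.
Proof.
move=> lm; apply: linear_lower_form => i q il.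
by rewrite red_mulX// -val_eqE /= neq_ltn (leq_trans il lm).
Qed.

Lemma red_square_diff m p : red m (square_diff m * p) = 0.
Proof.
by rewrite mulrBl raddfB /= red_mulXX expr2 -!mulrA !red_lower_form// subrr.
Qed.

Lemma sub_red m p : exists c, p - red m p = c * square_diff m.
Proof.
elim/mpolyind: p => [|c b p _ _ [d pE]].
  by exists 0; rewrite linear0 subrr mul0r.
have [e XE] : exists e, mpolyX R b - red_mnm m b = e * square_diff m.
  rewrite /red_mnm; set b' := Multinom _.
  have -> : mpolyX R b = mpolyX R b' * (X m ^+ 2) ^+ (b m)./2.
    rewrite -exprM mulnC !mpolyXn -mpolyXD; congr (mpolyX _ _).
    apply/mnmP => i; rewrite mnmDE !mulmnE mnm1E mnmE eq_sym.
    case: eqP => [->|_]; last by rewrite mul0n addn0.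
    by rewrite mul1n muln2 odd_double_half.
  (* A difference of equal powers of [X m ^+ 2] and [lower_form m ^+ 2] is divisible by
     [square_diff m]. *)
  rewrite -mul2n exprM -mulrBr subrXX mulrCA mulrC.
  by eexists.
exists (c *: e + d); rewrite linearP /= mlinX.
by rewrite opprD addrACA pE -scalerBr XE mulrDl scalerAl.
Qed.

Lemma normal_form k : exists M : {linear P -> P},
  [/\ forall l p, (l < k)%N -> M (X l * p) = X l * M p,
      forall m p, (k <= m)%N -> M (square_diff m * p) = 0
    & forall p, exists c, p - M p = \sum_(m < n | (k <= m)%N) c m * square_diff m].
Proof.
(* Downward induction on [k], starting with the identity once [n <= k]. *)
have [d nk] : exists d, (n <= k + d)%N by exists n; rewrite leq_addl.
elim: d k nk => [|d IH] k nk.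
  exists idfun; split=> //= [m p|p].
    by rewrite leqNgt (leq_trans (ltn_ord m)) // -[k]addn0.
  exists (fun=> 0); rewrite subrr big1// => i _; exact: mul0r.
have [|M [MX Mq Msub]] := IH k.+1; first by rewrite addSnnS.
have [kn|kn] := ltnP k n; last first.
  exists M; split=> // [l p lk|m p km|p]; first by apply: MX; apply: ltnW.
    by have:= leq_trans kn km; rewrite leqNgt ltn_ord.
  have [c cE] := Msub p; exists (fun=> 0); rewrite cE !big_pred0// => m.
    by rewrite leqNgt (leq_trans (ltn_ord m) kn).
  by rewrite leqNgt ltnS (ltnW (leq_trans (ltn_ord m) kn)).
pose o := Ordinal kn.
exists (red o \o M : {linear P -> P}); split=> /= [l p lk|m p|p].
- by rewrite MX ?ltnS 1?ltnW// red_mulX// -val_eqE /= neq_ltn lk.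
- rewrite leq_eqVlt => /orP[/eqP km|km]; last by rewrite Mq// linear0.
  have <- : o = m by apply: val_inj.
  by rewrite linear_square_diff ?red_square_diff// => l q lo; apply: MX.
- have [c cE] := Msub p; have [e eE] := sub_red o (M p).
  exists (fun m => if m == o then e else c m).
  rewrite (bigD1 o)//= eqxx -eE addrC -[LHS](subrKA (M p)) cE.
  congr (_ + _); apply: eq_big => m.
    by rewrite ltn_neqAle eq_sym andbC -val_eqE.
  by move=> km; rewrite -val_eqE /= gtn_eqF.
Qed.

(** The preimage in the polynomial ring of the ideal of the quotient generated by the first [k]
    variables; hence all relations are included. *)
Definition var_ideal k p := exists c d : 'I_n -> P,
  p = \sum_(l < n | (l < k)%N) c l * X l + \sum_m d m * square_diff m.

Lemma var_idealD k p q : var_ideal k p -> var_ideal k q -> var_ideal k (p + q).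
Proof.
move=> [c [d ->]] [c' [d' ->]]; exists (fun i => c i + c' i), (fun i => d i + d' i).
rewrite addrACA -!big_split; congr (_ + _); apply: eq_bigr => i _ /=; exact/esym/mulrDl.
Qed.

Lemma var_idealMl k p q : var_ideal k q -> var_ideal k (p * q).
Proof.
move=> [c [d ->]]; exists (fun i => p * c i), (fun i => p * d i).
by rewrite mulrDr !mulr_sumr; congr (_ + _); apply: eq_bigr => i _; rewrite mulrA.
Qed.

Lemma var_idealX k l : (l < k)%N -> var_ideal k (X l).
Proof.
move=> lk; exists (fun i => (i == l)%:R), (fun=> 0).
rewrite (bigD1 l)//= eqxx mul1r !big1 ?addr0//.
- by move=> i _; rewrite mul0r.
- by move=> i /andP[_ /negPf->]; rewrite mul0r.
Qed.

Lemma var_ideal0 k : var_ideal k 0.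
Proof.
by exists (fun=> 0), (fun=> 0); rewrite !big1 ?addr0// => i _; rewrite mul0r.
Qed.

Lemma var_ideal_sum k (I : Type) (r : seq I) (Q : pred I) (f : I -> P) :
  (forall j, Q j -> var_ideal k (f j)) -> var_ideal k (\sum_(j <- r | Q j) f j).
Proof.
move=> fk; elim/big_ind: _ => //; [exact: var_ideal0|exact: var_idealD].
Qed.

Lemma var_ideal_square_diff k m : var_ideal k (square_diff m).
Proof.
exists (fun=> 0), (fun i => (i == m)%:R).
rewrite big1 ?add0r; last by move=> i _; rewrite mul0r.
by rewrite (bigD1 m)//= eqxx mul1r big1 ?addr0// => i /negPf->; rewrite mul0r.
Qed.

(** A monomial divisible by some [X l] with [l < k] lies in the ideal, and the hypothesis excludes
    all others. *)
Lemma mcoeff_var_ideal p k :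
  (forall b : multinom n, (forall l, (l < k)%N -> b l = 0%N) -> mcoeff b p = 0) ->
  var_ideal k p.
Proof.
move=> p0; rewrite [p]mpolyE; apply: var_ideal_sum => b _.
have [/forallP b0|] := boolP [forall l : 'I_n, (l < k)%N ==> (b l == 0%N)].
  rewrite p0 ?scale0r; first exact: var_ideal0.
  by move=> l lk; have /implyP/(_ lk)/eqP := b0 l.
rewrite negb_forall => /existsP[l]; rewrite negb_imply -lt0n => /andP[lk bl].
suff -> : b = mnm_add (mnm_sub b (mnm1 l)) (mnm1 l).
  by rewrite mpolyXD scalerAl; apply/var_idealMl/var_idealX.
apply/mnmP => i; rewrite mnmDE mnmBE mnm1E; case: eqP => [<-|_].
  by rewrite subnK.
by rewrite subn0 addn0.
Qed.

(* Modulo x_l, l < i, the variable x_i generates its own annihilator. *)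
Lemma var_ideal_colon (i : 'I_n) p :
  var_ideal i (p * X i) <-> var_ideal i.+1 p.
Proof.
split; last first.
  move=> [c [d ->]]; rewrite mulrDl !mulr_suml; apply: var_idealD; last first.
    apply: var_ideal_sum => m _; rewrite mulrC.
    exact/var_idealMl/var_idealMl/var_ideal_square_diff.
  apply: var_ideal_sum => l; rewrite ltnS leq_eqVlt => /orP[/eqP/val_inj->|li]; last first.
    by rewrite mulrAC; apply/var_idealMl/var_idealX.
  (* Modulo a relation [X i ^+ 2] is [lower_form i ^+ 2], which involves earlier variables only. *)
  rewrite -mulrA -expr2; apply: var_idealMl.
  rewrite -[_ ^+ 2](subrK (lower_form i ^+ 2)).
  apply: var_idealD; first exact: var_ideal_square_diff.
  rewrite expr2; apply/var_idealMl/var_ideal_sum => l' li.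
  by rewrite -mul_mpolyC; apply/var_idealMl/var_idealX.
move=> [c [d pXE]].
(* [M] kills the relations of index above [i] and is linear over the variables up to [X i], so
   [M p * X i] involves only relations of index at most [i]. *)
have [M [MX Mq Msub]] := normal_form i.+1.
suff Mp0 : var_ideal i.+1 (M p).
  have [e eE] := Msub p; rewrite -[p](subrK (M p)) eE.
  apply: var_idealD => //; apply: var_ideal_sum => m _.
  exact/var_idealMl/var_ideal_square_diff.
apply: mcoeff_var_ideal => b b0.
(* Membership in the monomial ideal generated by [X i ^+ 2] and the [X l] with [l < i], which
   contains the relations of index at most [i]. *)
pose vanish (q : P) := forall b' : multinom n,
  (forall l, (l < i)%N -> b' l = 0%N) -> (b' i <= 1)%N -> mcoeff b' q = 0.
have vanish0 : vanish 0 by move=> b' _ _; rewrite mcoeff0.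
have vanishD q r : vanish q -> vanish r -> vanish (q + r).
  by move=> vq vr b' b'0 b'1; rewrite mcoeffD vq// vr// addr0.
have vanishZ c' q : vanish q -> vanish (c' *: q).
  by move=> vq b' b'0 b'1; rewrite mcoeffZ vq// mulr0.
have vanishX l q : (l < i)%N -> vanish (q * X l).
  move=> li b' b'0 _; apply: mcoeffMX_eq0; apply/mnm_lepP => /(_ l).
  by rewrite b'0// mnm1E eqxx.
have vanishXX q : vanish (q * X i ^+ 2).
  move=> b' _ b'1; rewrite mpolyXn; apply: mcoeffMX_eq0; apply/mnm_lepP => /(_ i).
  by rewrite mulmnE mnm1E eqxx mul1n leqNgt ltnS b'1.
have vanish_lower q (m : 'I_n) : (m <= i)%N -> vanish (q * lower_form m).
  move=> mi; rewrite mulr_sumr; elim/big_ind: _ => // l lm.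
  by rewrite -scalerAr; apply/vanishZ/vanishX/(leq_trans lm).
have vanish_sqd q (m : 'I_n) : (m <= i)%N -> vanish (q * square_diff m).
  move=> mi; rewrite mulrBr [lower_form m ^+ 2]expr2 -mulNr !mulrA.
  apply: (vanishD); last exact: vanish_lower.
  move: mi; rewrite leq_eqVlt => /orP[/eqP/val_inj->|mi].
    by rewrite -mulrA; apply: vanishXX.
  exact: vanishX.
(* As [b i = 0], multiplying by [X i] turns [b] into a monomial of degree one in [X i], to which
   [vanish] applies. *)
have -> : mcoeff b (M p) = mcoeff (mnm_add (mnm1 i) b) (M p * X i).
  by rewrite mcoeffMX.
suff : vanish (M p * X i).
  apply=> [l li|]; rewrite mnmDE mnm1E b0 ?ltnS ?(ltnW li)// addn0 ?leq_b1//.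
  by rewrite -val_eqE /= gtn_eqF.
rewrite mulrC -MX// [_ * p]mulrC pXE linearD !linear_sum /=; apply: (vanishD).
  elim/big_ind: _ => [|? ?|l li]; [exact: vanish0|exact: vanishD|].
  by rewrite mulrC MX 1?ltnW// mulrC; apply: vanishX.
elim/big_ind: _ => [|? ?|m _]; [exact: vanish0|exact: vanishD|].
have [mi|im] := leqP m i; last by rewrite mulrC Mq.
rewrite mulrC linear_square_diff => [|l q lm].
  by rewrite mulrC; apply: vanish_sqd.
by apply/MX/(leq_ltn_trans lm).
Qed.

End SquareDifferences.

(** * Linear resolution from a flag of ideals with the colon property *)

Section KoszulFlag.
Variables (k : fieldType) (A : comAlgType k) (G : nat -> set A).
Hypothesis gradedG : is_graded_algebra G.
Variables (n : nat) (x : 'I_n -> A).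
Hypothesis degx : forall i, G 1%N (x i).

Definition flag_ideal m a := exists c : 'I_n -> A,
  a = \sum_(l < n | (l < m)%N) c l * x l.

Hypothesis flag_colon : forall (i : 'I_n) a,
  flag_ideal i (a * x i) <-> flag_ideal i.+1 a.

Lemma homogD d a b : G d a -> G d b -> G d (a + b).
Proof.
by move=> da db; have := gradedP gradedG 1 da db; rewrite scale1r.
Qed.

Lemma homogN d a : G d a -> G d (- a).
Proof.
move=> da; rewrite -scaleN1r -[_ *: _]addr0.
by apply: (gradedP gradedG) => //; exact: (graded0 gradedG).
Qed.

Lemma homog_sum d (I : Type) (r : seq I) (Q : pred I) (f : I -> A) :
  (forall i, Q i -> G d (f i)) -> G d (\sum_(i <- r | Q i) f i).
Proof.
by move=> fd; elim/big_ind: _ => //; [exact: (graded0 gradedG)|exact: homogD].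
Qed.

Lemma homog_decomp (I : finType) (a : I -> A) : exists N (c : I -> nat -> A),
  [/\ (1 < N)%N, forall i d, G d (c i d) & forall i, a i = \sum_(0 <= d < N) c i d].
Proof.
have /choice[N /choice[c cP]] := fun i => graded_sum gradedG (a i).
(* The bound is at least two so that the degree-one component is always in range. *)
exists (\max_i N i).+2, (fun i d => if (d < N i)%N then c i d else 0).
split=> // i; have [ci aE] := cP i.
  by move=> d; case: ifP => _; [exact: ci|exact: (graded0 gradedG)].
rewrite aE -big_mkcondr /= !big_mkord (big_ord_widen_cond (\max_i N i).+2 predT (c i))//.
by rewrite -addn2 (leq_trans (leq_bigmax i)) ?leq_addr.
Qed.

(** Subtracting the whole sum from its component of degree [d] leaves a decomposition of zero, so
    directness applies. *)
Lemma homog_part d N (c : nat -> A) : (d < N)%N -> (forall e, G e (c e)) ->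
  G d (\sum_(0 <= e < N) c e) -> c d = \sum_(0 <= e < N) c e.
Proof.
move=> dN Gc; set a := (X in G d X) => Ga; apply/eqP; rewrite -subr_eq0; apply/eqP.
have Gc' e : G e (c e - if e == d then a else 0).
  apply: homogD => //; apply: homogN; case: eqP => [->//|_].
  exact: (graded0 gradedG).
have := graded_direct gradedG Gc' _ dN; rewrite eqxx; apply.
rewrite sumrB -/a big_mkord -big_mkcond /= (big_pred1 (Ordinal dN)) ?subrr//.
Qed.

(** Since [D] has linear entries, the degree-one part of a syzygy is again a syzygy. *)
Lemma linear_part r s (D : 'M[A]_(s, r)) (c : 'rV[A]_s) :
  (forall i j, G 1%N (D i j)) -> c *m D = 0 ->
  exists c' : 'rV[A]_s, [/\ c' *m D = 0, forall j, G 1%N (c' 0 j)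
    & forall j, G 1%N (c 0 j) -> c' 0 j = c 0 j].
Proof.
move=> GD cD0; have [N [f [N1 Gf fE]]] := homog_decomp (c 0).
exists (\row_j f j 1%N); split=> [|j|j Gc]; rewrite ?mxE//; last first.
  by rewrite fE; apply: homog_part => //; rewrite -fE.
apply/rowP => j; rewrite !mxE.
(* The degree [d] component of entry [j] of [c *m D]: the entries of [D] raise degrees by one, so
   the degree-one part of [c] contributes in degree two. *)
pose g d := if d is d'.+1 then \sum_i f i d' * D i j else 0.
have -> : \sum_i (\row_j0 f j0 1%N) 0 i * D i j = g 2.
  by apply: eq_bigr => i _; rewrite mxE.
apply: (graded_direct gradedG (N := N.+1)) => // [[|d]|].
- exact: (graded0 gradedG).
- by apply: homog_sum => i _; rewrite -addn1; apply: (gradedM gradedG).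
rewrite big_nat_recl// add0r exchange_big /=.
move/rowP: cD0 => /(_ j); rewrite !mxE => cD; apply: etrans cD; apply: eq_bigr => i _.
by rewrite fE mulr_suml.
Qed.


(** No term beyond [j] contributes, so [f j * x j] is a combination of the earlier [x l] and the
    colon identity applies. *)
Lemma flag_ideal_top (Q : pred 'I_n) (f : 'I_n -> A) (j : 'I_n) :
  \sum_(l < n | Q l) f l * x l = 0 -> (forall l : 'I_n, (l <= j)%N -> Q l) ->
  (forall l : 'I_n, Q l -> (j < l)%N -> f l = 0) -> flag_ideal j.+1 (f j).
Proof.
move=> f0 Qj fj; apply/flag_colon; exists (fun l => - f l).
move/eqP: f0; rewrite (bigD1 j) ?Qj//= addr_eq0 => /eqP->.
rewrite -sumrN big_mkcond [RHS]big_mkcond; apply: eq_bigr => l _ /=.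
rewrite mulNr -val_eqE; case: ltngtP => [lj|jl|_].
- by rewrite Qj// ltnW.
- by case: ifP => // /andP[Ql _]; rewrite fj// mul0r oppr0.
- by rewrite andbF.
Qed.

(* The colon ideal of row i of D by the rows preceding it in the order given by
   key is the ideal of the first lab i elements of x. It is expressed by the
   leading coefficients of the syzygies of D. *)
Definition linear_flag r s (D : 'M[A]_(s, r)) : Prop :=
  exists key lab : 'I_s -> nat,
  [/\ injective key, forall i j, G 1%N (D i j)
    & forall i a, flag_ideal (lab i) a <->
        exists c : 'rV[A]_s, [/\ c *m D = 0, c 0 i = a
          & forall j, (key i < key j)%N -> c 0 j = 0]].

(** The start of the iteration: the colon identity itself provides the label [j.+1] of row [j]. *)
Lemma linear_flag_col : linear_flag (\col_j x j).
Proof.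
have mulE (c : 'rV_n) : c *m (\col_j x j) = 0 <-> \sum_l c 0 l * x l = 0.
  have e : (c *m \col_j x j) 0 0 = \sum_l c 0 l * x l.
    by rewrite mxE; apply: eq_bigr => l _; rewrite mxE.
  rewrite -e; split=> [->|c0]; first by rewrite mxE.
  by apply/rowP => j; rewrite !ord1 c0 mxE.
exists (@nat_of_ord n), (fun j => j.+1); split; first exact: val_inj.
  by move=> i j; rewrite mxE.
move=> i a; split=> [/flag_colon[b aE]|[c [/mulE c0 <- ci]]].
  pose c l := if l == i then a else if (l < i)%N then - b l else 0.
  exists (\row_l c l); split; last 1 first.
  - by move=> j ij; rewrite mxE /c -val_eqE /= gtn_eqF// ltnNge ltnW.
  - apply/mulE; rewrite (bigD1 i)//= mxE /c eqxx aE [X in _ + X]big_mkcond.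
    rewrite [X in X + _]big_mkcond -big_split big1// => l _ /=.
    rewrite mxE -val_eqE /=; case: ltngtP; rewrite ?(mul0r, addr0, mulNr, subrr)//.
  - by rewrite mxE /c eqxx.
by apply: (@flag_ideal_top xpredT (c 0)) => // j _; apply: ci.
Qed.

(** The rows of [D'] are linear syzygies, one for each generator [x l] of each colon ideal of [D],
    with leading coefficient [x l]. They generate because the leading entry of any syzygy can be
    cancelled, and in lexicographic order the colon ideal at [(i, l)] reduces to that of [x l] by
    the earlier [x]. *)
Lemma linear_flag_step r s (D : 'M[A]_(s, r)) : linear_flag D ->
  exists s' (D' : 'M[A]_(s', s)), linear_flag D' /\
    forall c, c *m D = 0 <-> exists e : 'rV[A]_s', e *m D' = c.
Proof.
move=> [key [lab [key_inj GD DP]]].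
pose B := [set y : 'I_s * 'I_n | (y.2 < lab y.1)%N]%SET.
have /choice[u uP] (y : 'I_s * 'I_n) : exists u : 'rV[A]_s, y \in B ->
    [/\ u *m D = 0, forall j, G 1%N (u 0 j), u 0 y.1 = x y.2
      & forall j, (key y.1 < key j)%N -> u 0 j = 0].
  have [yB|_] := boolP (y \in B); last by exists 0.
  have [] := (DP y.1 (x y.2)).1.
    exists (fun l => (l == y.2)%:R).
    move: yB; rewrite inE => yB; rewrite (bigD1 y.2)//= eqxx mul1r big1 ?addr0//.
    by move=> l /andP[_ /negPf->]; rewrite mul0r.
  (* Passing to the linear part keeps the leading entry and the zeros beyond it, as these already
     have degree one. *)
  move=> c [cD cy c0]; have [c' [c'D Gc' c'E]] := linear_part GD cD.
  exists c' => _; split=> //; first by rewrite c'E cy.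
  by move=> j /c0 cj; rewrite c'E cj//; exact: (graded0 gradedG).
pose comb (e : 'I_s * 'I_n -> A) := \sum_(y in B) e y *: u y.
have combD e : comb e *m D = 0.
  rewrite mulmx_suml big1// => y yB; rewrite -scalemxAl.
  by have [-> _ _ _] := uP y yB; rewrite scaler0.
have combB e e' : comb (fun y => e y - e' y) = comb e - comb e'.
  by rewrite /comb -sumrB; apply: eq_bigr => y _; rewrite scalerBl.
(* Generators attached to rows of smaller key vanish at [i], and those of larger key have
   coefficient zero. *)
have comb_top e i : (forall y, y \in B -> (key i < key y.1)%N -> e y = 0) ->
    comb e 0 i = \sum_(l < n | (l < lab i)%N) e (i, l) * x l.
  move=> e0; rewrite summxE.
  have -> : \sum_(y in B) (e y *: u y) 0 i =
      \sum_i' \sum_(l < n | (l < lab i')%N) (e (i', l) *: u (i', l)) 0 i.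
    by rewrite pair_big_dep; apply: eq_big => [[i' l]|[i' l] _]; rewrite ?inE.
  rewrite (bigD1 i)//=.
  rewrite [X in _ + X]big1 ?addr0 => [|i' ii'].
    apply: eq_bigr => l il; rewrite mxE.
    by have [|_ _ -> _] := uP (i, l); rewrite ?inE.
  rewrite big1// => l il; have yB : (i', l) \in B by rewrite inE.
  have [_ _ _ u0] := uP _ yB; rewrite mxE.
  have [ki|ki|/key_inj ki] := ltngtP (key i) (key i').
  - by rewrite e0// mul0r.
  - by rewrite u0// mulr0.
  - by rewrite ki eqxx in ii'.
have comb_above e K j : (forall y, y \in B -> (K < key y.1)%N -> e y = 0) ->
    (K < key j)%N -> comb e 0 j = 0.
  move=> e0 Kj; rewrite summxE big1// => y yB; rewrite mxE.
  have [Ky|yK] := ltnP K (key y.1); first by rewrite e0// mul0r.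
  by have [_ _ _ ->] := uP _ yB; rewrite ?mulr0// (leq_ltn_trans yK).
(* Induction on a strict bound [K] for the keys in the support: the entry of largest key is
   cancelled by generators attached to its row. *)
have gen K : forall c : 'rV[A]_s, c *m D = 0 ->
    (forall j, (K <= key j)%N -> c 0 j = 0) ->
    exists e, (forall y, y \in B -> (K <= key y.1)%N -> e y = 0) /\ c = comb e.
  elim: K => [|K IH] c cD c0.
    exists (fun=> 0); split=> //; rewrite /comb big1 => [|y _]; last exact: scale0r.
    by apply/rowP => j; rewrite c0// mxE.
  have [[i iK]|noK] := pselect (exists i, key i = K); last first.
    have [|e [e0 cE]] := IH c cD.
      move=> j; rewrite leq_eqVlt => /orP[/eqP Kj|]; last exact: c0.
      by case: noK; exists j.
    by exists e; split=> // y yB /ltnW; apply: e0.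
  have [|b bE] := (DP i (c 0 i)).2.
    by exists c; split=> // j ij; apply: c0; rewrite -iK.
  pose e1 (y : 'I_s * 'I_n) := if y.1 == i then b y.2 else 0.
  have e10 y : y \in B -> (K < key y.1)%N -> e1 y = 0.
    move=> _; rewrite /e1; case: eqP => // ->; by rewrite iK ltnn.
  have [||e2 [e20 cE]] := IH (c - comb e1).
  - by rewrite mulmxBl cD combD subrr.
  - move=> j; rewrite leq_eqVlt => /orP[/eqP Kj|Kj].
      have <- : i = j by apply: key_inj; rewrite iK.
      rewrite !mxE comb_top; last by rewrite iK.
      rewrite [X in X - _]bE; apply/eqP; rewrite subr_eq0; apply/eqP.
      by apply: eq_bigr => l _; rewrite /e1 eqxx.
    by rewrite !mxE c0// (comb_above _ K)// subrr.
  exists (fun y => e2 y - (- e1 y)); split=> [y yB Ky|].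
    by rewrite e10// e20 ?(ltnW Ky)// oppr0 subr0.
  rewrite combB -cE; have -> : comb (fun y => - e1 y) = - comb e1.
    by rewrite /comb -sumrN; apply: eq_bigr => y _; rewrite scaleNr.
  by rewrite opprK subrK.
pose D' : 'M[A]_(#|B|, s) := \matrix_(q, j) u (enum_val q) 0 j.
have combE e : (\row_q e (enum_val q)) *m D' = comb e.
  apply/rowP => j; rewrite mxE summxE.
  rewrite (big_enum_val (fun y => (e y *: u y) 0 j)).
  by apply: eq_bigr => q _; rewrite !mxE.
have ext (e' : 'rV[A]_#|B|) : exists e, e' = \row_q e (enum_val q).
  exists (fun y => \sum_(q < #|B| | enum_val q == y) e' 0 q).
  apply/rowP => q; rewrite mxE (big_pred1 q)// => q'.
  by rewrite (inj_eq enum_val_inj).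
exists #|B|, D'; split; last first.
  move=> c; split=> [cD|[e' <-]]; last by have [e ->] := ext e'; rewrite combE combD.
  have [|e [_ ->]] := gen (\max_j key j).+1 c cD.
    by move=> j; rewrite ltnNge leq_bigmax.
  by exists (\row_q e (enum_val q)).
(* Since [y.2 < n], this number encodes the lexicographic order. *)
pose key2 (y : 'I_s * 'I_n) := (key y.1 * n + y.2)%N.
have key2P y z : (key2 y < key2 z)%N ->
    (key y.1 < key z.1)%N \/ y.1 = z.1 /\ (y.2 < z.2)%N.
  rewrite /key2; have [|zy|/key_inj ->] := ltngtP (key y.1) (key z.1).
  - by left.
  - rewrite ltnNge => /negP[]; apply: leq_trans (leq_addr _ _).
    apply: (@leq_trans ((key z.1).+1 * n)%N); last by rewrite leq_mul2r zy orbT.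
    by rewrite mulSn addnC leq_add2r ltnW.
  - by rewrite ltn_add2l; right.
have key2_inj : injective key2.
  move=> [i j] [i' j'] /= e; have n0 : (0 < n)%N := leq_ltn_trans (leq0n j) (ltn_ord j).
  move: e; rewrite /key2 /= => e.
  have := congr1 (divn^~ n) e; rewrite !divnMDl// !divn_small// !addn0 => /key_inj->.
  by have := congr1 (modn^~ n) e; rewrite !modnMDl !modn_small// => /val_inj->.
exists (fun q => key2 (enum_val q)),
  (fun q : 'I_#|B| => (@enum_val _ (mem B) q).2.+1); split.
- by move=> q q' /key2_inj /enum_val_inj.
- by move=> q j; rewrite mxE; have [] := uP _ (enum_valP q).
move=> q a; have := enum_valP q; case qE: (enum_val q) => [i j] yB.
have ij : (j < lab i)%N by move: yB; rewrite inE.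
split=> /= [/flag_colon[b aE]|[e' [e'D <- e'0]]].
  (* The relation expressing [a * x j] makes entry [i] of [comb e1] vanish. The rest has smaller
     keys, so [gen] rewrites it with generators of smaller rows, and [e1 - e2] is a syzygy with
     leading coefficient [a]. *)
  pose e1 (y : 'I_s * 'I_n) := if y.1 != i then 0 else
    if y.2 == j then a else if (y.2 < j)%N then - b y.2 else 0.
  have e10 y : y \in B -> (key i < key y.1)%N -> e1 y = 0.
    by move=> _; rewrite /e1; case: eqP => //= ->; rewrite ltnn.
  have [||e2 [e20 e12]] := gen (key i) (comb e1); first exact: combD.
    move=> i'; rewrite leq_eqVlt => /orP[/eqP/key_inj <-|]; last first.
      by apply: comb_above.
    rewrite comb_top// (bigD1 j)//= /e1 !eqxx /= aE.
    rewrite big_mkcond [X in _ + X]big_mkcond -big_split big1// => l _ /=.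
    rewrite -val_eqE /=; case: ltngtP => [lj|_|_]; rewrite ?andbF ?mul0r ?if_same ?addr0//.
    by rewrite (ltn_trans lj ij) mulNr subrr.
  exists (\row_q (e1 (enum_val q) - e2 (enum_val q))); split.
  - by rewrite (combE (fun y => e1 y - e2 y)) combB e12 subrr.
  - by rewrite mxE qE /e1 /= !eqxx /= e20 ?subr0.
  - move=> q'; rewrite mxE => /key2P /=.
    case: (enum_val q') (enum_valP q') => i' j' y'B /=.
    case=> [ii'|[ei jj']]; last first.
      rewrite e20 ?ei// /e1 /= -ei eqxx /= -val_eqE /= gtn_eqF// ltnNge ltnW//.
      exact: subr0.
    by rewrite e10// e20 ?subr0// ltnW.
have [e eE] := ext e'; move: e'D e'0; rewrite {}eE combE mxE qE => comb0 e0.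
have {}e0 y : y \in B -> (key2 (i, j) < key2 y)%N -> e y = 0.
  by move=> y'B; have := e0 (enum_rank_in y'B y); rewrite mxE enum_rankK_in.
(* Entry [i] of [comb e = 0] is a relation among the [x l] with no term beyond [j]. *)
have := comb_top e i; rewrite comb0 mxE => top.
have := @flag_ideal_top (fun l => (l < lab i)%N) (fun l => e (i, l)) j.
apply=> [|l lj|l li jl]; last 1 first.
- by apply: e0; rewrite ?inE// /key2 ltn_add2l.
- rewrite -top// => y y'B iy; apply: e0 => //; rewrite /key2 /=.
  apply: (@leq_trans ((key i).+1 * n)%N).
    by rewrite mulSn addnC ltn_add2r.
  by apply: leq_trans (leq_addr _ _); rewrite leq_mul2r iy orbT.
- exact: leq_ltn_trans ij.
Qed.

(** Bundling the sizes with the matrix allows iteration although the sizes change at each step. *)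
Record flag_stage := FlagStage {
  stage_tgt : nat;
  stage_src : nat;
  stage_mx : 'M[A]_(stage_src, stage_tgt);
  stageP : linear_flag stage_mx }.

Definition next_stage (S : flag_stage) : flag_stage :=
  let s := cid (linear_flag_step (stageP S)) in
  let D := cid (projT2 s) in
  @FlagStage (stage_src S) (projT1 s) (projT1 D) (projT2 D).1.

Lemma next_stageP S (c : 'rV_(stage_src S)) :
  c *m stage_mx S = 0 <->
  exists e : 'rV_(stage_src (next_stage S)), e *m stage_mx (next_stage S) = c.
Proof. exact: (projT2 (cid (projT2 (cid (linear_flag_step (stageP S)))))).2. Qed.

Definition stage i := iter i next_stage (FlagStage linear_flag_col).

Definition flag_rank i := if i is j.+1 then stage_src (stage j) else 0%N.

(** Both branches are [stage_mx (stage i)]; the case split lets the ranks compute to the sizes of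
    that stage. *)
Definition flag_mx i : 'M[A]_(res_rank flag_rank i.+1, res_rank flag_rank i) :=
  match i with 0%N => stage_mx (stage 0) | j.+1 => stage_mx (stage j.+1) end.

Lemma homog_flag_mx i p q : G 1%N (flag_mx i p q).
Proof.
case: i p q => [|i] p q.
  by have [? [? [_ h _]]] := stageP (stage 0); exact: h.
by have [? [? [_ h _]]] := stageP (stage i.+1); exact: h.
Qed.

Lemma koszul_flag (eps : {lrmorphism A -> k^o}) :
  (forall e a, (0 < e)%N -> G e a -> eps a = 0) ->
  (forall a, eps a = 0 -> flag_ideal n a) -> koszul G.
Proof.
move=> eps_deg eps_ker; split=> //.
exists eps, flag_rank, (fun i => mulmxr (flag_mx i) : {linear _ -> _}); split=> //.
- move=> i e v vdeg j; rewrite /= mxE; case: ifPn => ie; last first.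
    by rewrite big1// => l _; have := vdeg l; rewrite ifN;
      [move=> ->; rewrite mul0r|apply: contra ie; apply: ltnW].
  apply: homog_sum => l _; have := vdeg l; case: ifP => [ie' vl|_ ->].
    rewrite -subSS subSn// -addn1; apply: (gradedM gradedG) => //.
    exact: homog_flag_mx.
  (* Here [e = i], and the entries of [v] are zero because the source is shifted by one more. *)
  by rewrite mul0r; exact: (graded0 gradedG).
- by move=> c; exists c%:A; rewrite linearZ /= rmorph1 /GRing.scale /= mulr1.
- move=> v; split=> [/eps_ker[c vE]|[u <-]].
    exists (\row_l c l); apply/rowP => j; rewrite !ord1 vE /= mxE [RHS]big_mkcond.
    by apply: eq_bigr => l _; rewrite ltn_ord !mxE.
  rewrite /= mxE rmorph_sum big1// => l _; rewrite rmorphM /= mxE.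
  by rewrite (eps_deg _ _ _ (degx l))// mulr0.
- case=> [|i] v; [exact: (@next_stageP (stage 0))|exact: (@next_stageP (stage i.+1))].
Qed.

End KoszulFlag.

(** * The Bott-Samelson ring: colon identity, grading and augmentation *)

Section BottSamelsonKoszul.
Local Open Scope quotient_scope.
Variables (R : realType) (C : coxeterSystem) (n : nat).
Variable w : n.-tuple (cox_set C).
Local Notation P := (mpoly n R).
Local Notation X i := (mpolyX R (mnm1 i)).
Local Notation A := (BS R w).

Definition bs_pi (p : P) : A := \pi_({ideal_quot (@bs_ideal R C n w)}) p.

Lemma bs_pi_is_linear : linear bs_pi.
Proof.
move=> c p q; rewrite /bs_pi rmorphD; congr (_ + _).
exact: (@pi_idealq_scale R P (@bs_ideal R C n w)).
Qed.

Lemma bs_pi_is_monoid_morphism : monoid_morphism bs_pi.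
Proof. by split=> [|p q]; [exact: rmorph1|exact: rmorphM]. Qed.

HB.instance Definition _ := GRing.isLinear.Build R P A _ bs_pi bs_pi_is_linear.
HB.instance Definition _ :=
  GRing.isMonoidMorphism.Build P A bs_pi bs_pi_is_monoid_morphism.

Lemma bs_piK (a : A) : bs_pi (repr a) = a.
Proof. exact: reprK. Qed.

Lemma pi_BS_eq p q : (bs_pi p = bs_pi q) <->
  exists c : 'I_n -> P, p - q = \sum_m c m * bs_q R w m.
Proof.
split=> [/eqP|pq].
  by rewrite -Quotient.idealrBE => /asboolP.
by apply/eqP; rewrite -Quotient.idealrBE; apply/asboolP.
Qed.

Lemma pi_BS_eq0 p : (bs_pi p = 0) <->
  exists c : 'I_n -> P, p = \sum_m c m * bs_q R w m.
Proof. by rewrite -[0](rmorph0 bs_pi) pi_BS_eq subr0. Qed.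

(** [bs_q] is [square_diff] for the coefficients [bs_Q]. Lifting coefficients with [repr] leaves an
    error that is a combination of relations. *)
Lemma flag_ideal_BS k p : flag_ideal (fun i => bs_pi (X i)) k (bs_pi p) <->
  var_ideal (fun l m => bs_Q R w l m) k p.
Proof.
split=> [[c cE]|[c [d ->]]]; last first.
  exists (fun i => bs_pi (c i)); rewrite rmorphD /=.
  have -> : bs_pi (\sum_m d m * square_diff (fun l m => bs_Q R w l m) m) = 0.
    by apply/pi_BS_eq0; exists d.
  by rewrite addr0 rmorph_sum; apply: eq_bigr => l _; rewrite rmorphM.
have [d dE] : exists d : 'I_n -> P,
    p - \sum_(l < n | (l < k)%N) repr (c l) * X l = \sum_m d m * bs_q R w m.
  apply/pi_BS_eq; rewrite cE rmorph_sum; apply: eq_bigr => l _.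
  by rewrite rmorphM /= bs_piK.
by exists (fun l => repr (c l)), d; rewrite addrC; apply/eqP; rewrite -subr_eq -dE.
Qed.

Lemma flag_colon_BS (i : 'I_n) (a : A) :
  flag_ideal (fun i => bs_pi (X i)) i (a * bs_pi (X i)) <->
  flag_ideal (fun i => bs_pi (X i)) i.+1 a.
Proof.
rewrite -[a]bs_piK -rmorphM !flag_ideal_BS; exact: var_ideal_colon.
Qed.

Lemma lower_form_homog (a : 'I_n -> 'I_n -> R) m :
  lower_form a m \is ishomog1 1 mdeg.
Proof. by apply: rpred_sum => l _; apply: rpredZ; rewrite dhomogX /= mdeg1. Qed.

Lemma bs_q_homog m : bs_q R w m \is ishomog1 2 mdeg.
Proof.
apply: rpredB; rewrite -[2%N]mul1n; apply: dhomogMn; last exact: lower_form_homog.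
by rewrite dhomogX /= mdeg1.
Qed.

Lemma pihomogMr d e (p q : P) : q \is ishomog1 e mdeg ->
  pihomog mdeg (d + e) (p * q) = pihomog mdeg d p * q.
Proof.
move=> qe; have [N] : exists N, (mmeasure mdeg p <= N)%N /\ (d < N)%N.
  by exists (maxn (mmeasure mdeg p) d.+1); rewrite leq_maxl leq_maxr.
case=> pN dN; rewrite {1}(pihomog_partitionE pN) mulr_suml linear_sum /=.
rewrite (bigD1 (Ordinal dN))//= big1 ?addr0.
  by rewrite pihomog_dE// dhomogM// pihomogP.
move=> i; rewrite -val_eqE /= => id.
apply: (pihomog_ne0 (d := (i + e)%N)); first by rewrite eqn_add2r.
by rewrite dhomogM// pihomogP.
Qed.

Lemma pihomogMr_lt d e (p q : P) : q \is ishomog1 e mdeg -> (d < e)%N ->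
  pihomog mdeg d (p * q) = 0.
Proof.
move=> qe de; rewrite (pihomog_partitionE (leqnn (mmeasure mdeg p))).
rewrite mulr_suml linear_sum big1// => i _ /=.
apply: (pihomog_ne0 (d := (i + e)%N)); last by rewrite dhomogM// pihomogP.
by rewrite gtn_eqF// ltn_addl.
Qed.

(** The ideal of relations is homogeneous because its generators are homogeneous of degree two. *)
Lemma pi_BS_pihomog d p : bs_pi p = 0 -> bs_pi (pihomog mdeg d p) = 0.
Proof.
move=> /pi_BS_eq0[c ->]; rewrite (linear_sum (pihomog mdeg d)) linear_sum /=.
apply: big1 => m _.
have [d2|d2] := ltnP d 2.
  by rewrite (pihomogMr_lt _ (bs_q_homog m))// rmorph0.
rewrite -(subnK d2) (pihomogMr _ _ (bs_q_homog m)); apply/pi_BS_eq0.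
exists (fun m' => if m' == m then pihomog mdeg (d - 2) (c m) else 0).
by rewrite (bigD1 m)//= eqxx big1 ?addr0// => m' /negPf->; rewrite mul0r.
Qed.

Lemma graded_BS : is_graded_algebra (BS_deg R w).
Proof.
split.
- by move=> d; exists 0; rewrite ?rmorph0//; exact: rpred0.
- move=> d c _ _ [p pd <-] [q qd <-]; exists (c *: p + q).
    by apply: rpredD => //; apply: rpredZ.
  exact: bs_pi_is_linear.
- by exists 1; rewrite ?rmorph1//; exact: dhomog1.
- move=> d e _ _ [p pd <-] [q qe <-]; exists (p * q); last exact: rmorphM.
  exact: dhomogM.
- move=> a; exists (mmeasure mdeg (repr a)), (fun d => bs_pi (pihomog mdeg d (repr a))).
  split=> [d|]; first by exists (pihomog mdeg d (repr a)) => //; exact: pihomogP.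
  rewrite big_mkord -rmorph_sum -pihomog_partitionE//.
  by rewrite /= bs_piK.
- move=> N c cP c0 d dN.
  have /choice[p pP] e : exists p : P, p \is ishomog1 e mdeg /\ bs_pi p = c e.
    by have [p ? ?] := cP e; exists p.
  (* The degree [d] component of this lift is [p d], so homogeneity of the ideal gives [c d = 0]. *)
  have : bs_pi (\sum_(0 <= e < N) p e) = 0.
    by rewrite rmorph_sum -[RHS]c0; apply: eq_bigr => e _; have [] := pP e.
  move=> /(pi_BS_pihomog d); rewrite (linear_sum (pihomog mdeg d)) big_mkord.
  rewrite (bigD1 (Ordinal dN))//=; have [pd <-] := pP d; rewrite (pihomog_dE pd) big1 ?addr0// => e ed.
  by apply: pihomog_ne0 (pP e).1.
Qed.

Definition BS_eps (a : A) : R^o := mcoeff mnm0 (repr a : P).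

(** The relations have no constant term, so the choice of representative does not matter. *)
Lemma BS_eps_pi p : BS_eps (bs_pi p) = mcoeff mnm0 p.
Proof.
have [c cE] : exists c : 'I_n -> P, repr (bs_pi p) - p = \sum_m c m * bs_q R w m.
  by apply/pi_BS_eq; rewrite bs_piK.
apply/eqP; rewrite -subr_eq0 -mcoeffB cE raddf_sum big1// => m _.
by rewrite /= rmorphM /= mcoeff0_bs_q mulr0.
Qed.

Lemma BS_eps_is_linear : linear BS_eps.
Proof.
move=> c a b; rewrite -[a]bs_piK -[b]bs_piK -linearP /= !BS_eps_pi.
by rewrite mcoeffD mcoeffZ.
Qed.

Lemma BS_eps_is_monoid_morphism : monoid_morphism BS_eps.
Proof.
split=> [|a b]; first by rewrite -(rmorph1 bs_pi) BS_eps_pi mcoeff1 eqxx.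
by rewrite -[a]bs_piK -[b]bs_piK -rmorphM /= !BS_eps_pi rmorphM.
Qed.

HB.instance Definition _ := GRing.isLinear.Build R A R^o _ BS_eps BS_eps_is_linear.
HB.instance Definition _ :=
  GRing.isMonoidMorphism.Build A R^o BS_eps BS_eps_is_monoid_morphism.

End BottSamelsonKoszul.

Theorem theorem4p3 (R : realType) (C : coxeterSystem) (n : nat)
    (w : n.-tuple (cox_set C)) : koszul (BS_deg R w).
Proof.
apply: (koszul_flag (graded_BS R w) _ (@flag_colon_BS R C n w) (eps := BS_eps (w := w))).
- by move=> i; exists (mpolyX R (mnm1 i)) => //; rewrite /= dhomogX /= mdeg1.
- move=> e _ e0 [p pe <-]; rewrite /= BS_eps_pi (dhomog_nemf_coeff pe)//.
  by rewrite /= mdeg0 eq_sym -lt0n.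
- move=> a; rewrite -[a]bs_piK /= BS_eps_pi => a0; apply/flag_ideal_BS.
  (* The only monomial free of all [n] variables is the constant one, whose coefficient is zero by
     [a0]. *)
  apply: mcoeff_var_ideal => b b0; suff -> : b = mnm0 by [].
  by apply/mnmP => l; rewrite mnm0E b0.
Qed.
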